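(* Let $V$ be an $n$-dimensional real inner product space, $q$ a positive definite quadratic form on $V$, and $C\subseteq V$ a closed convex polyhedral cone. For $a\in V$, $R\in\mathbb{R}$ let $\mathbb{B}_q(a,R)=\{x\in V:q(x-a)\leq R^2\}$. Then there exists a polynomial function $g_{C,q}$ on $\mathbb{R}\times V$ such that: (a) $g_{C,q}$ is homogeneous of degree $n$; (b) $g_{C,q}(R,a)=g_{C,q}(-R,a)$ for all $(R,a)\in\mathbb{R}\times V$; (c) for every $(R,a)\in\mathbb{R}\times V$ with $q(a)\leq R^2$, $$\mathrm{Vol}(C\cap\mathbb{B}_q(a,R))+(-1)^{n}\mathrm{Vol}((-C)\cap\mathbb{B}_q(a,R))=g_{C,q}(R,a).$$
   Context: A closed convex polyhedral cone is an intersection of finitely many closed half-spaces whose boundary hyperplanes pass through the origin. $\mathrm{Vol}$ is Lebesgue measure on $V$ (defined via the inner product). *)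

(* Defs.v *)
From HB Require Import structures.
From mathcomp Require Import all_boot all_order all_algebra.
From mathcomp Require Import all_classical all_reals all_analysis.
From mathcomp Require mpoly.

Set Implicit Arguments.
Unset Strict Implicit.
Unset Printing Implicit Defensive.

Import Order.TTheory GRing.Theory Num.Theory.
Local Open Scope classical_set_scope.
Local Open Scope ring_scope.

Section cons_pair.
Context d (T : measurableType d) (n : nat).

Definition cons_pair (p : T * n.-tuple T) : n.+1.-tuple T :=
  [tuple of p.1 :: p.2].

Let measurable_cons_pair : measurable_fun [set: T * n.-tuple T] cons_pair.
Proof.
exact: (@measurable_cons _ _ _ _ fst _ snd measurable_fst measurable_snd).
Qed.

HB.instance Definition _ :=
  isMeasurableFun.Build _ _ _ _ cons_pair measurable_cons_pair.

Definition uncons (t : n.+1.-tuple T) : T * n.-tuple T :=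
  (thead t, [tuple of behead t]).

Lemma cons_pairK : cancel cons_pair uncons.
Proof. by case=> x t; rewrite /uncons theadE; congr pair; exact/val_inj. Qed.

Lemma unconsK : cancel uncons cons_pair.
Proof. by move=> t; rewrite [RHS]tuple_eta. Qed.

Lemma measurable_uncons : measurable_fun [set: n.+1.-tuple T] uncons.
Proof.
by apply: measurable_fun_pair; [exact: measurable_tnth|exact: measurable_behead].
Qed.

End cons_pair.

Section lebesgue_cons.
Context (R : realType).
Local Notation T := (measurableTypeR R).
Local Open Scope ereal_scope.
Variables (n : nat) (m : {sigma_finite_measure set (n.-tuple T) -> \bar R}).

Definition lebesgue_cons : set (n.+1.-tuple T) -> \bar R :=
  pushforward (@lebesgue_measure R \x m) (@cons_pair _ T n).

Let lebesgue_cons0 : lebesgue_cons set0 = 0.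
Proof. exact: measure0. Qed.

Let lebesgue_cons_ge0 A : 0 <= lebesgue_cons A.
Proof. exact: measure_ge0. Qed.

Let lebesgue_cons_sigma_additive : semi_sigma_additive lebesgue_cons.
Proof. exact: measure_semi_sigma_additive. Qed.

HB.instance Definition _ := isMeasure.Build _ _ _ lebesgue_cons
  lebesgue_cons0 lebesgue_cons_ge0 lebesgue_cons_sigma_additive.

Let lebesgue_cons_sigma_finite : sigma_finite setT lebesgue_cons.
Proof.
have /sigma_finiteP[F [TF ndF Foo]] := sigma_finiteT (@lebesgue_measure R).
have /sigma_finiteP[G [TG ndG Goo]] := sigma_finiteT m.
exists (fun k => @uncons _ T n @^-1` (F k `*` G k)).
  rewrite -preimage_bigcup (_ : \bigcup_k _ = setT) ?preimage_setT//.
  rewrite -subTset => -[x y] _.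
  have [i _ Fix] : (\bigcup_k F k) x by rewrite -TF.
  have [j _ Gjy] : (\bigcup_k G k) y by rewrite -TG.
  exists (maxn i j) => //; split.
  - by move: x Fix; exact/subsetPset/ndF/leq_maxl.
  - by move: y Gjy; exact/subsetPset/ndG/leq_maxr.
move=> k; have [mF Fk] := Foo k; have [mG Gk] := Goo k; split.
  rewrite -[X in measurable X]setTI.
  by apply: measurable_uncons => //; exact: measurableX.
rewrite /lebesgue_cons /pushforward -comp_preimage.
rewrite (_ : _ \o _ = id); last by apply/funext => p /=; exact: cons_pairK.
by rewrite preimage_id product_measure1E// lte_mul_pinfty// ge0_fin_numE.
Qed.

HB.instance Definition _ := Measure_isSigmaFinite.Build _ _ _ lebesgue_cons
  lebesgue_cons_sigma_finite.

End lebesgue_cons.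

(* Lebesgue measure on R^n, as the n-fold product of the one on R. *)
Fixpoint lebesgue_tuple (R : realType) (n : nat) :
    {sigma_finite_measure set (n.-tuple (measurableTypeR R)) -> \bar R} :=
  if n is k.+1 then lebesgue_cons (lebesgue_tuple R k)
  else \d_ [tuple].

Section volume.
Context (R : realType) (V : vectType R) (dot : {dot V for idfun}).

Let dotC (u v : V) : dot u v = dot v u.
Proof. by rewrite hermC expr0 mul1r. Qed.

Let proj (s : seq V) (v : V) := \sum_(x <- s) dot v x *: x.

Let dot_proj s v w : orthonormal dot s -> w \in s -> dot (proj s v) w = dot v w.
Proof.
elim: s => // x s IH; rewrite /orthonormal /= => /andP[/andP[/eqP xx ons]].
rewrite !andbT => /andP[xs os].
have {}xs y : y \in s -> dot x y = 0 by move=> /(allP xs)/eqP.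
have {}IH := IH _; rewrite /orthonormal in IH.
rewrite /proj big_cons linearDl /= linearZl_LR /= inE => /predU1P[->|ws].
  rewrite xx mulr1 linear_sumlz big_seq big1 ?addr0// => y /xs xy.
  by rewrite linearZl_LR /= [dot y x]dotC xy mulr0.
by rewrite xs// mulr0 add0r IH//= ons.
Qed.

Let orthonormal_free s : orthonormal dot s -> free s.
Proof.
move=> ons; have : {in s, forall w, forall v, dot (proj s v) w = dot v w}.
  by move=> w ws v; exact: dot_proj.
elim: s ons => [|x s IH]; first by rewrite nil_free.
rewrite /orthonormal /= => /andP[/andP[/eqP xx ons]].
rewrite !andbT => /andP[/allP xs os] _.
rewrite free_cons IH ?andbT; last 2 first.
- by rewrite /orthonormal ons.
- by move=> w ws v; apply: dot_proj => //; rewrite /orthonormal ons.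
apply: contraT; rewrite negbK => xspan.
suff : dot x x = 0 by rewrite xx => /eqP; rewrite oner_eq0.
rewrite -[s]in_tupleE in xspan; rewrite {2}(coord_span xspan) linear_sumr.
rewrite big1// => i _; rewrite linearZr_LR /=.
by have /xs/eqP -> := mem_nth 0 (ltn_ord i); rewrite mulr0.
Qed.

Let orthonormal_extend s : orthonormal dot s -> (size s < \dim {:V})%N ->
  exists x, orthonormal dot (x :: s).
Proof.
move=> ons sV.
have [v vs] : exists v, v \notin (span s).
  apply: contrapT => /forallNP vs; move: sV; rewrite ltnNge => /negP; apply.
  apply: leq_trans (dim_span s); apply: dimvS; apply/subvP => v _.
  by move: (vs v) => /negP; rewrite negbK.
pose u := v - proj s v.
have u0 : u != 0.
  apply: contra vs; rewrite subr_eq0 => /eqP ->.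
  rewrite /proj big_seq; apply: memv_suml => x xs.
  by rewrite memvZ// memv_span.
have uu : 0 < dot u u by exact: neq0_dnorm_gt0.
exists ((Num.sqrt (dot u u))^-1 *: u).
move: (ons); rewrite {1 2}/orthonormal /= => /andP[-> ->]; rewrite !andbT.
apply/andP; split.
  rewrite linearZl_LR linearZr_LR /= mulrA -invfM -expr2 sqr_sqrtr ?ltW//.
  by rewrite mulVf ?lt0r_neq0.
apply/allP => w ws; rewrite inE linearZl_LR /=.
suff -> : dot u w = 0 by rewrite mulr0.
by rewrite /u linearBl /= dot_proj// subrr.
Qed.

Lemma orthonormal_basis_exists :
  exists e : (\dim {:V}).-tuple V, basis_of {:V} e && orthonormal dot e.
Proof.
have ex k : (k <= \dim {:V})%N -> exists2 s, size s = k & orthonormal dot s.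
  elim: k => [_|k IH kV]; first by exists [::].
  have [s sk ons] := IH (ltnW kV).
  have [|x xs] := orthonormal_extend ons; first by rewrite sk.
  by exists (x :: s) => //=; rewrite sk.
have [s ss ons] := ex _ (leqnn _).
exists (tcast ss (in_tuple s)); rewrite val_tcast /= ons andbT.
by rewrite basisEfree subvf orthonormal_free// ss leqnn.
Qed.

Definition orthonormal_basis : (\dim {:V}).-tuple V :=
  projT1 (cid orthonormal_basis_exists).

Lemma orthonormal_basisP :
  basis_of {:V} orthonormal_basis && orthonormal dot orthonormal_basis.
Proof. exact: projT2 (cid orthonormal_basis_exists). Qed.

(* Lebesgue measure of V, transported from R^n along the coordinates in an
   orthonormal basis; it does not depend on the basis, because Lebesgue measure
   on R^n is invariant under orthogonal maps. *)
Definition Vol (A : set V) : \bar R :=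
  lebesgue_tuple R (\dim {:V})
    [set t | A (\sum_i tnth t i *: tnth orthonormal_basis i)].

End volume.

Section polynomial_function.
(* local Import, because mpoly redefines names of the analysis library *)
Import -(notations) mpoly.
Context (R : realType) (W : vectType R).

(* The function on W given by a polynomial in the coordinates with respect to
   the basis vbasis {:W}. Since a linear change of coordinates preserves
   (homogeneous) polynomials, this choice of basis is immaterial below. *)
Definition mpoly_fun (p : mpoly (\dim {:W}) R) (w : W) : R :=
  meval (fun i => coord (vbasis {:W}) i w) p.

Definition polynomial_function (g : W -> R) : Prop :=
  exists p, g = mpoly_fun p.

Definition homogeneous_polynomial_function (d : nat) (g : W -> R) : Prop :=
  exists2 p, p \is ishomog1 d mdeg & g = mpoly_fun p.

End polynomial_function.

Section cones_and_balls.
Context (R : realType) (V : vectType R).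

Definition quadratic_form (q : V -> R) : Prop :=
  exists b : {symmetric V}, forall x, q x = b x x.

Definition positive_definite (q : V -> R) : Prop :=
  forall x, x != 0 -> 0 < q x.

Definition closed_half_space (dot : {dot V for idfun}) (w : V) : set V :=
  [set x | 0 <= dot w x].

Definition polyhedral_cone (dot : {dot V for idfun}) (C : set V) : Prop :=
  exists2 s : seq V, 0 \notin s &
    C = \bigcap_(w in [set` s]) closed_half_space dot w.

Definition qball (q : V -> R) (a : V) (r : R) : set V :=
  [set x | q (x - a) <= r ^+ 2].

End cones_and_balls.

(* Main.v *)
Require Import Defs.
From HB Require Import structures.
From mathcomp Require Import all_boot all_order all_algebra.
From mathcomp Require Import all_classical all_reals all_analysis.
From mathcomp Require Import measurable_realfun ring lra.
From mathcomp Require mpoly.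

(* Write V in coordinates and parametrize the half-space H = {t_0 > 0} by
   t = s (1, y) with s > 0 and y in R^k, n = k + 1, so that dt = s^k ds dy. Let
   D be a cone in H, put u = (1, y), and let s- <= 0 <= s+ be the roots of
   q(s u - a) = R^2, which are real when q(a) <= R^2. Then Vol(D \cap B(a,R)) is
   the integral of s+^n / n over the y with u in D. Replacing a by -a replaces
   s+ by -s-, so
     Vol(D \cap B(a,R)) + (-1)^n Vol(D \cap B(-a,R))
   is the integral of (s+^n + s-^n) / n. With b the bilinear form of q, this
   power sum is a polynomial in s+ + s- = 2 b(a,u) / q(u) and
   s+ s- = (q(a) - R^2) / q(u), hence a sum of terms c(y) h(R,a) with h
   homogeneous of degree n, even in R, and |c(y)| <= K q(u)^(-n/2); the latter
   is integrable because a half-ball has finite volume. A general cone C is, up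
   to a null set, C \cap H together with the reflection of (-C) \cap H. *)

Set Implicit Arguments.
Unset Strict Implicit.
Unset Printing Implicit Defensive.

Import Order.TTheory GRing.Theory Num.Theory.
Local Open Scope classical_set_scope.
Local Open Scope ring_scope.

(** * Closure properties of homogeneous polynomial functions *)

Section homogeneous_polynomial_functions.
Import -(notations) mpoly.
Context (R : realType) (W : vectType R).
Local Notation hpoly := (@homogeneous_polynomial_function R W).

Lemma homogeneous_polynomial d g : hpoly d g -> polynomial_function g.
Proof. by case=> p _ ->; exists p. Qed.

Lemma hpolyD d f g : hpoly d f -> hpoly d g -> hpoly d (fun w => f w + g w).
Proof.
move=> [p hp ->] [r hr ->]; exists (p + r); first exact: mpoly.dhomogD.
by apply/funext => w; rewrite /mpoly_fun mpoly.mevalD.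
Qed.

Lemma hpolyM d d' f g :
  hpoly d f -> hpoly d' g -> hpoly (d + d') (fun w => f w * g w).
Proof.
move=> [p hp ->] [r hr ->]; exists (p * r); first exact: mpoly.dhomogM.
by apply/funext => w; rewrite /mpoly_fun mpoly.mevalM.
Qed.

Lemma hpolyZ d c f : hpoly d f -> hpoly d (fun w => c * f w).
Proof.
move=> [p hp ->]; exists (c *: p); first exact: mpoly.dhomogZ.
by apply/funext => w; rewrite /mpoly_fun mpoly.mevalZ.
Qed.

Lemma hpoly_cst c : hpoly 0 (fun=> c).
Proof.
exists (c *: 1); first by apply: mpoly.dhomogZ; exact: mpoly.dhomog1.
by apply/funext => w; rewrite /mpoly_fun mpoly.mevalZ mpoly.meval1 mulr1.
Qed.

Lemma hpoly0 d : hpoly d (fun=> 0).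
Proof.
exists 0; first exact: mpoly.dhomog0.
by apply/funext => w; rewrite /mpoly_fun mpoly.meval0.
Qed.

Lemma hpoly_sum d (I : Type) (s : seq I) (f : I -> W -> R) :
  (forall i, hpoly d (f i)) -> hpoly d (fun w => \sum_(i <- s) f i w).
Proof.
move=> hf; elim: s => [|i s IH].
  under eq_fun do rewrite big_nil.
  exact: hpoly0.
under eq_fun do rewrite big_cons.
exact: hpolyD.
Qed.

(** In the coordinates of [vbasis], a linear form is a combination of monomials of degree one, with
    its values on the basis as coefficients. *)
Lemma hpoly_linear (f : W -> R) :
  (forall a u v, f (a *: u + v) = a * f u + f v) -> hpoly 1 f.
Proof.
move=> lf; pose F : W -> R^o := f.
pose mF := GRing.isLinear.Build R W R^o _ F lf.
pose G : {linear W -> R^o} := HB.pack F mF.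
rewrite (_ : f = fun w => \sum_i G (tnth (vbasis {:W}) i) *
                             coord (vbasis {:W}) i w); last first.
  apply/funext => w; rewrite [in LHS](_ : f w = G w)//.
  rewrite {1}(coord_vbasis (memvf w)) linear_sum.
  apply: eq_bigr => i _; rewrite linearZ /= (tnth_nth 0).
  exact: mulrC.
apply: hpoly_sum => i; apply: hpolyZ; exists (mpoly.mpolyX R (mpoly.mnm1 i)).
  by rewrite mpoly.dhomogX /= mpoly.mdeg1.
by apply/funext => w; rewrite /mpoly_fun mpoly.mevalXU.
Qed.

End homogeneous_polynomial_functions.

(** * Lebesgue measure on R^n: scaling, slices, boxes and a hyperplane *)

Section lebesgue_tuple.
Context (R : realType).
Local Notation T := (measurableTypeR R).
Local Notation mu := (@lebesgue_measure R).
Local Open Scope ereal_scope.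

(** Both sides are measures in [A], so by uniqueness of Lebesgue measure it suffices to compare them
    on intervals ]x, y]. For c < 0 the preimage is half-open on the other side, which does not
    affect its length. *)
Lemma lebesgue_measure_scale (c : R) (A : set T) : c != 0%R ->
  measurable A -> `|c|%:E * mu ( *%R c @^-1` A) = mu A.
Proof.
move=> c0 mA.
have mc : measurable_fun [set: T] ( *%R c : T -> T) by exact: mulrl_measurable.
pose c' := NngNum (normr_ge0 c).
pose f : T -> T := *%R c.
pose nu' : {measure set T -> \bar R} := mscale c' (pushforward mu f).
pose nu := nu' mc.
suff : forall X, measurable X -> mu X = nu X by move=> /(_ A mA) ->.
apply: lebesgue_measure_unique => _ [[x y] /= _ <-].
rewrite /nu /nu' /= /mscale /= /pushforward.
have [xy|yx] := leP y x.
  by rewrite set_itv_ge -?leNgt ?bnd_simp// preimage_set0 !measure0 mule0.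
have [cp|cn] : (0 < c)%R \/ (c < 0)%R by apply/orP; rewrite orbC -neq_lt.
  rewrite (_ : _ @^-1` _ = `](x / c)%R, (y / c)%R]%classic); last first.
    apply/seteqP; split => z /=; rewrite !in_itv /= /f (mulrC c).
      by rewrite ltr_pdivrMr// ler_pdivlMr.
    by rewrite ltr_pdivrMr// ler_pdivlMr.
  rewrite !lebesgue_measure_itv /= !lte_fin ltr_pM2r ?invr_gt0// yx.
  by rewrite gtr0_norm// -!EFinD -EFinM mulrBr !(mulrC c) !divfK.
rewrite (_ : _ @^-1` _ = `[(y / c)%R, (x / c)%R[%classic); last first.
  apply/seteqP; split => z /=; rewrite !in_itv /= /f (mulrC c).
    by rewrite ltr_ndivlMr// ler_ndivrMr// => /andP[-> ->].
  by rewrite ltr_ndivlMr// ler_ndivrMr// => /andP[-> ->].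
rewrite !lebesgue_measure_itv /= !lte_fin ltr_nM2r ?invr_lt0// yx.
by rewrite ltr0_norm// -!EFinD -EFinM mulNr mulrBr !(mulrC c) !divfK// opprB.
Qed.

Lemma ge0_integral_scale (c : R) (F : T -> \bar R) : c != 0%R ->
  measurable_fun [set: T] F -> (forall x, 0 <= F x) ->
  `|c|%:E * \int[mu]_x F (c * x)%R = \int[mu]_x F x.
Proof.
move=> c0 mF F0.
have mc : measurable_fun [set: T] ( *%R c : T -> T) by exact: mulrl_measurable.
pose c' := NngNum (normr_ge0 c).
pose f : T -> T := *%R c.
pose nu' : {measure set T -> \bar R} := mscale c' (pushforward mu f).
pose nu := nu' mc.
transitivity (\int[nu]_x F x); last first.
  apply: eq_measure_integral => A mA _.
  by rewrite /nu /nu' /= /mscale /= /pushforward lebesgue_measure_scale.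
rewrite ge0_integral_mscale//; congr (_ * _).
by rewrite ge0_integral_pushforward.
Qed.

Lemma lebesgue_tupleS n (A : set (n.+1.-tuple T)) :
  lebesgue_tuple R n.+1 A =
  \int[mu]_x lebesgue_tuple R n [set t | A (cons_pair (x, t))].
Proof.
apply: eq_integral => x _ /=; congr (lebesgue_tuple R n _).
by apply/seteqP; split => t /=; rewrite /xsection /= in_setE.
Qed.

Lemma measurable_cons_preimage n (A : set (n.+1.-tuple T)) :
  measurable A -> measurable (@cons_pair _ T n @^-1` A).
Proof.
by move=> mA; rewrite -[X in measurable X]setTI; exact: measurable_funP.
Qed.

Lemma measurable_lebesgue_section n (A : set (n.+1.-tuple T)) : measurable A ->
  measurable_fun setT
    (fun x : T => lebesgue_tuple R n [set t | A (cons_pair (x, t))]).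
Proof.
move=> mA; have := measurable_fun_xsection (lebesgue_tuple R n)
  (measurable_cons_preimage mA).
congr (measurable_fun _ _); apply/funext => x /=.
congr (lebesgue_tuple R n _).
by apply/seteqP; split => t /=; rewrite /xsection /= in_setE.
Qed.

Definition scale_tuple n (c : R) (t : n.-tuple T) : n.-tuple T :=
  [tuple of map ( *%R c) t].

Lemma scale_tuple_cons n c (x : T) (t : n.-tuple T) :
  scale_tuple c (cons_pair (x, t)) =
  cons_pair ((c * x)%R : T, scale_tuple c t).
Proof. exact/val_inj. Qed.

Lemma measurable_scale_tuple n c :
  measurable_fun setT (@scale_tuple n c).
Proof.
apply/measurable_fun_tnthP => i.
rewrite (_ : _ \o _ = fun t : n.-tuple T => (c * tnth t i)%R); last first.
  by apply/funext => t /=; rewrite tnth_map.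
apply: (measurableT_comp (mulrl_measurable c)); exact: measurable_tnth.
Qed.

(** Induction on [n]: the substitution in the first coordinate contributes one factor |c|, and the
    slices contribute the others. *)
Lemma lebesgue_tuple_scale n (c : R) (A : set (n.-tuple T)) : c != 0%R ->
  measurable A ->
  (`|c| ^+ n)%:E * lebesgue_tuple R n (scale_tuple c @^-1` A) =
  lebesgue_tuple R n A.
Proof.
move=> c0; elim: n A => [A _|n IH A mA].
  rewrite expr0 mul1e; congr (lebesgue_tuple R 0 _).
  by apply/seteqP; split => t /=; rewrite (tuple0 t) (tuple0 (scale_tuple _ _)).
rewrite !lebesgue_tupleS.
rewrite -(@ge0_integral_scale c (fun x => lebesgue_tuple R n
  [set t | A (cons_pair (x, t))]))//; last exact: measurable_lebesgue_section.
rewrite exprS EFinM -muleA; congr (_ * _).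
have mcA : measurable (@scale_tuple n.+1 c @^-1` A).
  by rewrite -[X in measurable X]setTI; exact: measurable_scale_tuple.
rewrite -ge0_integralZl//; last exact: measurable_lebesgue_section mcA.
apply: eq_integral => x _; rewrite -[RHS]IH; last first.
  rewrite -[X in measurable X]setTI.
  have mx : measurable_fun setT (fun t : n.-tuple T =>
      cons_pair ((c * x)%R : T, t)).
    apply: (@measurable_cons _ _ _ _ (fun _ => (c * x)%R : T) _ id) => //.
  exact: mx.
congr (_ * _); congr (lebesgue_tuple R n _).
by apply/seteqP; split => t /=; rewrite scale_tuple_cons.
Qed.

Lemma lebesgue_tuple_cons_setX n (A : set T) (B : set (n.-tuple T)) :
  measurable A -> measurable B ->
  lebesgue_tuple R n.+1 [set t | A (thead t) /\ B [tuple of behead t]] =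
  mu A * lebesgue_tuple R n B.
Proof.
move=> mA mB; rewrite -product_measure1E//.
congr ((mu \x lebesgue_tuple R n) _).
apply/seteqP; split => -[x t] /=; rewrite /cons_pair /= theadE.
  by move=> [Ax]; rewrite (_ : [tuple of _] = t)//; exact/val_inj.
by move=> [Ax Bt]; split => //; rewrite (_ : [tuple of _] = t)//; exact/val_inj.
Qed.

(** Balls will be shown to have finite volume by enclosing them in such a box. *)
Lemma lebesgue_tuple_box_lty n (M : R) :
  lebesgue_tuple R n [set t | forall i, `|tnth t i|%R <= M]%R < +oo.
Proof.
elim: n => [|n IH].
  by rewrite /= diracE; case: (_ \in _); rewrite ltry.
have -> : [set t : n.+1.-tuple T | forall i, (`|tnth t i| <= M)%R] =
    [set t | [set x : R | `|x| <= M]%R (thead t) /\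
      [set t : n.-tuple T | forall i, `|tnth t i|%R <= M]%R
        [tuple of behead t]].
  apply/seteqP; split => t /=.
    move=> tM; split; first exact: tM.
    by move=> i; rewrite tnth_behead.
  move=> [t0 tM] i; have [->//|i0] := eqVneq i ord0.
  have i1n : (i.-1 < n)%N by rewrite prednK ?lt0n// -ltnS.
  have := tM (Ordinal i1n); rewrite tnth_behead (_ : inord _ = i)//.
  by apply/val_inj; rewrite /= prednK ?lt0n// inordK.
have mM : measurable [set x : R | `|x| <= M]%R.
  rewrite (_ : mkset _ = `[(- M)%R, M]%classic); last first.
    by apply/seteqP; split => x /=; rewrite in_itv /= ler_norml.
  exact: measurable_itv.
rewrite lebesgue_tuple_cons_setX//; last first.
  rewrite (_ : mkset _ = \bigcap_(i in [set: 'I_n])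
    [set t | `|tnth t i| <= M]%R); last first.
    by apply/seteqP; split => t /= tM i; [move=> _|]; exact: tM.
  apply: fin_bigcap_measurable => // i _.
  have := @measurable_tnth _ T n i measurableT _ mM.
  by rewrite setTI.
apply: lte_mul_pinfty => //; rewrite ge0_fin_numE//.
rewrite (_ : mkset _ = `[(- M)%R, M]%classic); last first.
  by apply/seteqP; split => x /=; rewrite in_itv /= ler_norml.
by rewrite lebesgue_measure_itv /=; case: ifP => _; rewrite ?ltry// -EFinD ltry.
Qed.

(** This null set covers what is lost when a cone is cut into its parts in t_0 > 0 and t_0 < 0. *)
Lemma lebesgue_tuple_hyperplane n :
  lebesgue_tuple R n.+1 [set t | thead t = 0%R] = 0.
Proof.
rewrite (_ : mkset _ =
    [set t | [set 0%R : R] (thead t) /\ setT [tuple of behead t]]); last first.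
  by apply/seteqP; split => t //=; case.
by rewrite lebesgue_tuple_cons_setX// lebesgue_measure_set1 mul0e.
Qed.

End lebesgue_tuple.

(** * Reflection, dilations and the open half-space in coordinates *)

Section tuple_space.
Context (R : realType) (n : nat).
Local Notation T := (measurableTypeR R).

Lemma scale_tupleK (c : R) (t : n.-tuple T) : c != 0 ->
  scale_tuple c^-1 (scale_tuple c t) = t.
Proof.
by move=> c0; apply: eq_from_tnth => i; rewrite !tnth_map; exact: mulKf.
Qed.

Lemma scale_tupleN1K : involutive (@scale_tuple R n (-1)).
Proof.
move=> t; have N0 : (-1 : R) != 0 by rewrite oppr_eq0 oner_eq0.
by rewrite -{2}(scale_tupleK t N0) invrN1.
Qed.

Lemma measurable_opp_tuple (A : set (n.-tuple T)) : measurable A ->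
  measurable (scale_tuple (-1) @^-1` A).
Proof.
by move=> mA; rewrite -[X in measurable X]setTI; exact: measurable_scale_tuple.
Qed.

Lemma lebesgue_opp_tuple (A : set (n.-tuple T)) : measurable A ->
  lebesgue_tuple R n (scale_tuple (-1) @^-1` A) = lebesgue_tuple R n A.
Proof.
move=> mA; rewrite -[RHS](@lebesgue_tuple_scale _ _ (-1)) ?oppr_eq0 ?oner_eq0//.
by rewrite normrN normr1 expr1n mul1e.
Qed.

Definition positively_homogeneous (D : set (n.-tuple T)) :=
  forall c t, 0 < c -> D t -> D (scale_tuple c t).

Definition half_space : set (n.+1.-tuple T) := [set t | 0 < thead t :> R].

Lemma measurable_half_space : measurable half_space.
Proof.
rewrite -[X in measurable X]setTI.
by apply: measurable_fun_ltr => //; exact: measurable_tnth.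
Qed.

Lemma measurable_cons_cst (x : R) :
  measurable_fun setT (fun y : n.-tuple T => cons_pair (x : T, y)).
Proof. exact: (@measurable_cons _ _ _ _ (fun _ => x : T) _ id). Qed.

Lemma measurable_slice (x : R) (D : set (n.+1.-tuple T)) : measurable D ->
  measurable [set y | D (cons_pair (x : T, y))].
Proof.
by move=> mD; rewrite -[X in measurable X]setTI; exact: measurable_cons_cst.
Qed.

End tuple_space.
Arguments half_space : clear implicits.

(** * Integration along the rays through the slice t_0 = 1 *)

Section radial.
Import numFieldNormedType.Exports.
Context (R : realType).
Local Notation T := (measurableTypeR R).
Local Notation mu := (@lebesgue_measure R).
Local Open Scope ereal_scope.

Lemma integral_pow k (t : R) : (0 <= t)%R ->
  \int[mu]_(x in `]0%R, t]) (x ^+ k)%:E = (t ^+ k.+1 / k.+1%:R)%:E.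
Proof.
rewrite le_eqVlt => /predU1P[<-|t0].
  by rewrite set_itvoc0 integral_set0 expr0n mul0r.
have mX D : measurable_fun D (fun x : R => x ^+ k)%R by exact: exprn_measurable.
rewrite integral_itv_obnd_cbnd; last exact: measurableT_comp.
pose p : {poly R} := (k.+1%:R^-1 *: 'X^(k.+1))%R.
have p'E (x : R) : (p^`().[x] = x ^+ k)%R.
  rewrite derivZ derivXn hornerZ hornerMn hornerXn.
  rewrite -[X in (_ * X)%R]mulr_natl mulKf//.
rewrite (@continuous_FTC2 _ (fun x => x ^+ k)%R (horner p))//.
- by rewrite !hornerZ !hornerXn expr0n mulr0 sube0 mulrC.
- by apply: continuous_subspaceT => x; exact: exprn_continuous.
- split.
  + by move=> x _; exact: derivable_horner.
  + by apply: cvg_at_right_filter; exact: continuous_horner.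
  + by apply: cvg_at_left_filter; exact: continuous_horner.
- by move=> x _; rewrite -derivE p'E.
Qed.

(** This is the substitution t = x (1, y), with Jacobian x^k. The ray through (1, y) meets [D] for x
    in ]0, tau y] if y is in [E] and not at all otherwise, so integrating x^k along it gives
    [f y]. *)
Lemma lebesgue_tuple_radial k (D : set (k.+1.-tuple T)) (E : set (k.-tuple T))
    (tau : k.-tuple T -> R) :
  measurable D -> (forall t, D t -> 0 < thead t)%R ->
  (forall y, 0 <= tau y)%R ->
  (forall (y : k.-tuple T) (x : R), 0 < x ->
    D (scale_tuple x (cons_pair ((1 : R) : T, y))) <-> E y /\ x <= tau y)%R ->
  let f := (fun y => (\1_E y * (tau y ^+ k.+1 / k.+1%:R))%:E) in
  measurable_fun setT f /\
  lebesgue_tuple R k.+1 D = \int[lebesgue_tuple R k]_y f y.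
Proof.
move=> mD D0 tau0 DE f.
pose P : set (T * k.-tuple T) :=
  [set p | D (scale_tuple p.1 (cons_pair ((1 : R) : T, p.2)))]%R.
have mg : measurable_fun setT
    (fun p : T * k.-tuple T =>
       scale_tuple p.1 (cons_pair ((1%R : R) : T, p.2))).
  apply/measurable_fun_tnthP => i.
  rewrite (_ : _ \o _ = fun p : T * k.-tuple T =>
     (p.1 * tnth (cons_pair ((1%R : R) : T, p.2)) i)%R); last first.
    by apply/funext => t /=; rewrite tnth_map.
  apply: measurable_funM => //.
  apply: (measurableT_comp (@measurable_tnth _ T k.+1 i)).
  exact: (@measurable_cons _ _ _ _ (fun _ => (1%R : R) : T) _ snd).
have mP : measurable P by rewrite -[X in measurable X]setTI; exact: mg.
pose F (p : T * k.-tuple T) : \bar R := ((p.1 ^+ k)%:E * (\1_P p)%:E).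
(* For x <= 0 both sides fail; on the left, because the first coordinate of x (1, y) is x. *)
have PE x y : P (x, y) <-> (E y /\ x \in `]0%R, tau y])%R.
  rewrite in_itv /=; have [x0|x0] := ltP 0%R x; first exact: DE.
  split; last by case.
  move/D0; rewrite scale_tuple_cons theadE mulr1 => /(le_lt_trans x0).
  by rewrite ltxx.
have F0 p : 0 <= F p.
  rewrite /F; case: p => x y; rewrite -EFinM lee_fin indicE.
  case: (boolP (_ \in P)) => [|_]; last by rewrite mulr0.
  rewrite in_setE => /PE[_]; rewrite in_itv /= mulr1 => /andP[x0 _].
  by rewrite exprn_ge0// ltW.
have mF : measurable_fun setT F.
  apply: emeasurable_funM.
    by apply/measurable_EFinP; apply: measurable_funX.
  by apply/measurable_EFinP; exact: measurable_indic.
have GE : fubini_G mu F = f.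
  apply/funext => y; rewrite /fubini_G /F /f /=.
  rewrite (_ : (fun x => _) = fun x => ((\1_E y)%:E *
      patch (fun=> 0) (`]0%R, tau y]%classic) (fun x => (x ^+ k)%:E) x));
    last first.
    apply/funext => x; rewrite patchE !indicE.
    have -> : ((x, y) \in P) = (y \in E) && (x \in `]0%R, tau y]%classic).
      apply/idP/idP; rewrite in_setE.
        by move=> /PE[Ey xt]; rewrite !mem_set.
      by move=> /andP[]; rewrite !in_setE => Ey xt; apply/PE.
    by case: ifP; rewrite ?andbT ?andbF ?mule0// muleC.
  rewrite ge0_integralZl//; last 2 first.
  - apply/(measurable_restrictT _ _).1 => //.
    apply/measurable_EFinP; exact: exprn_measurable.
  - move=> x _; rewrite patchE; case: ifP => //.
    rewrite in_setE /= in_itv /= lee_fin => /andP[x0 _].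
    by rewrite exprn_ge0// ltW.
  by rewrite -integral_mkcond integral_pow.
split; first by rewrite -GE; exact: measurable_fun_fubini_tonelli_G.
(* Tonelli: integrating [F] over x first gives [f], over y first gives the measures of the slices of
   [D]. *)
rewrite -GE -fubini_tonelli2// fubini_tonelli1// lebesgue_tupleS.
apply: eq_integral => x _; rewrite /fubini_F /F /=.
have [x0|x0] := ltP 0%R x; last first.
  rewrite (_ : mkset _ = set0) ?measure0; last first.
    rewrite -subset0 => t /D0; rewrite theadE => /(le_lt_trans x0).
    by rewrite ltxx.
  rewrite integral0_eq// => y _; rewrite indicE memNset ?mule0//.
  by move/PE => [_]; rewrite in_itv /= ltNge x0.
have mDx : measurable [set t : k.-tuple T | D (cons_pair (x : T, t))].
  rewrite -[X in measurable X]setTI.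
  exact: (@measurable_cons _ _ _ _ (fun _ => x : T) _ id).
(* The slice of [D] at height x is the dilation by x of the set of y with [P (x, y)], whence the
   factor x^k. *)
rewrite -(@lebesgue_tuple_scale _ _ x) ?gt_eqF// gtr0_norm//.
rewrite ge0_integralZl//; last 2 first.
- apply/measurable_EFinP; apply: (measurableT_comp (measurable_indic mP)).
  exact: measurable_pair1.
- by rewrite lee_fin exprn_ge0// ltW.
congr (_ * _); rewrite (_ : (fun y => _) =
    (fun y => (\1_[set y | P (x, y)] y)%:E)); last first.
  by apply/funext => y; rewrite !indicE.
rewrite integral_indic//; last first.
  rewrite -[X in measurable X]setTI; apply: (measurable_pair1 x) => //.
rewrite setIT; congr (lebesgue_tuple R k _).
by apply/seteqP; split => y /=; rewrite /P /= scale_tuple_cons mulr1.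
Qed.

End radial.

(** * Cauchy-Schwarz, orthonormal expansions and bounds on linear forms *)

Section dot_product.
Context (R : realType) (V : vectType R) (b : {dot V for idfun}).

Lemma dotC u v : b u v = b v u.
Proof. by rewrite hermC expr0 mul1r. Qed.

Lemma dot_ge0 u : 0 <= b u u.
Proof.
have [->|u0] := eqVneq u 0; first by rewrite linear0l.
exact/ltW/neq0_dnorm_gt0.
Qed.

Lemma dotZl c u v : b (c *: u) v = c * b u v.
Proof. by rewrite linearZl_LR. Qed.

Lemma dotZr c u v : b u (c *: v) = c * b u v.
Proof. by rewrite linearZr_LR. Qed.

Lemma dotZBB (c : R) u a :
  b (c *: u - a) (c *: u - a) = c ^+ 2 * b u u - 2 * c * b a u + b a a.
Proof.
rewrite linearBl /= !linearBr /= !(dotZl, dotZr) (dotC u a).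
ring.
Qed.

Lemma dot_CauchySchwarz u v : b u v ^+ 2 <= b u u * b v v.
Proof.
have [->|v0] := eqVneq v 0; first by rewrite !linear0r expr0n.
have vv : 0 < b v v by exact: neq0_dnorm_gt0.
(* This vector is [b v v] times the component of [u] orthogonal to [v]; its square norm is [b v v]
   times the difference of the two sides. *)
have := dot_ge0 (b v v *: u - b u v *: v).
rewrite dotZBB !(dotZl, dotZr) (dotC v u).
rewrite (_ : _ + _ = b v v * (b u u * b v v - b u v ^+ 2)); last by ring.
by rewrite pmulr_rge0// subr_ge0.
Qed.

Lemma orthonormal_expand (s : seq V) v : orthonormal b s -> v \in span s ->
  v = \sum_(x <- s) b v x *: x.
Proof.
elim: s v => [v _|x s IH v].
  by rewrite span_nil memv0 big_nil => /eqP.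
rewrite /orthonormal /= => /andP[/andP[/eqP xx ons]].
rewrite !andbT => /andP[/allP xs os].
rewrite span_cons => /memv_addP[_ /vlineP[c ->]] [w ws ->].
have {}IH := IH w _ ws; rewrite /orthonormal ons os in IH.
have {}IH := IH isT.
have wx : b w x = 0.
  rewrite IH linear_sumlz big_seq big1// => y /xs /eqP xy.
  by rewrite linearZl_LR /= [b y x]dotC xy mulr0.
rewrite big_cons linearDl /= dotZl xx wx addr0 mulr1; congr (_ + _).
rewrite {1}IH; apply: eq_big_seq => y /xs /eqP xy.
by rewrite linearDl /= dotZl xy mulr0 add0r.
Qed.

(* In an orthonormal basis f for b, v is the sum of the b(v,f_j) f_j, and
   |b(v,f_j)|^2 <= b(v,v). *)
Lemma linear_dot_bounded (l : {linear V -> R^o}) :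
  exists2 K, 0 <= K & forall v, `|l v| <= K * Num.sqrt (b v v).
Proof.
have /andP[/andP[/eqP sf _] onf] := orthonormal_basisP b.
set f := orthonormal_basis b in sf onf.
exists (\sum_(x <- f) `|l x|); first exact: sumr_ge0.
move=> v; rewrite {1}(@orthonormal_expand f v) ?sf ?memvf//.
rewrite linear_sum mulr_suml; apply: le_trans (ler_norm_sum _ _ _) _.
rewrite !big_seq; apply: ler_sum => x xf.
rewrite linearZ /= normrM mulrC ler_wpM2l//.
rewrite -sqrtr_sqr ler_wsqrtr// (le_trans (dot_CauchySchwarz _ _))//.
by move: onf => /andP[/allP /(_ _ xf) /eqP -> _]; rewrite mulr1.
Qed.

End dot_product.

(** Newton's recurrence for x^n + y^n in terms of s = x + y and p = x y. For the two roots, it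
    removes the square roots of the discriminant. *)
Fixpoint power_sum (R : pzRingType) (s p : R) n : R :=
  if n is m.+1 then
    if m is l.+1 then s * power_sum s p m - p * power_sum s p l else s
  else 2.

Lemma power_sumE (R : comPzRingType) (x y : R) n :
  power_sum (x + y) (x * y) n = x ^+ n + y ^+ n.
Proof.
(* The recurrence reaches back two steps, so the induction carries two consecutive values. *)
have [] : power_sum (x + y) (x * y) n = x ^+ n + y ^+ n /\
  power_sum (x + y) (x * y) n.+1 = x ^+ n.+1 + y ^+ n.+1; last by [].
elim: n => [|n [IH1 IH2]]; first by rewrite /= !expr0 !expr1 -natr1.
split=> //; transitivity ((x + y) * power_sum (x + y) (x * y) n.+1 -
  (x * y) * power_sum (x + y) (x * y) n); first by [].
rewrite IH1 IH2 !exprS; ring.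
Qed.

(** * Balls in the coordinates of a basis: measurability and finite volume *)

Section ball_in_coordinates.
Context (R : realType) (V : vectType R) (n : nat) (e : n.-tuple V).
Context (b : {dot V for idfun}).
Context (basis_e : basis_of {:V} e).
Local Notation T := (measurableTypeR R).

Definition lincomb (t : n.-tuple T) : V :=
  \sum_i (tnth t i : R) *: tnth e i.

Lemma lincombZ c (t : n.-tuple T) : lincomb (scale_tuple c t) = c *: lincomb t.
Proof.
rewrite /lincomb scaler_sumr; apply: eq_bigr => i _.
by rewrite tnth_map scalerA.
Qed.

Lemma coord_lincomb i (t : n.-tuple T) : coord e i (lincomb t) = tnth t i.
Proof.
rewrite /lincomb; under eq_bigr do rewrite (tnth_nth 0 e).
by rewrite coord_sum_free// (basis_free basis_e).
Qed.

Lemma measurable_linear_lincomb (l : {linear V -> R^o}) :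
  measurable_fun setT (fun t : n.-tuple T => l (lincomb t) : R).
Proof.
rewrite (_ : (fun t => _) =
    fun t : n.-tuple T => \sum_i tnth t i * l (tnth e i)); last first.
  apply/funext => t; rewrite /lincomb linear_sum.
  by apply: eq_bigr => i _; rewrite linearZ.
apply: measurable_sum => i; apply: measurable_funM => //.
exact: (@measurable_tnth _ T).
Qed.

Lemma dot_scalar_linear (a : V) :
  linear_for ( *:%R : R -> R^o -> R^o) (b a : V -> R^o).
Proof. by move=> c u v; rewrite linearDr /= dotZr. Qed.

Definition dot_linear (a : V) : {linear V -> R^o} :=
  HB.pack (b a : V -> R^o)
    (GRing.isLinear.Build R V R^o _ (b a : V -> R^o) (dot_scalar_linear a)).

Lemma measurable_dot_lincomb a :
  measurable_fun setT (fun t : n.-tuple T => b a (lincomb t)).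
Proof. exact: (measurable_linear_lincomb (dot_linear a)). Qed.

Lemma measurable_dot2_lincomb :
  measurable_fun setT (fun t : n.-tuple T => b (lincomb t) (lincomb t)).
Proof.
rewrite (_ : (fun t => _) = fun t : n.-tuple T =>
    \sum_i tnth t i * b (tnth e i) (lincomb t)); last first.
  apply/funext => t; rewrite {1}/lincomb linear_sumlz.
  by apply: eq_bigr => i _; rewrite linearZl_LR.
apply: measurable_sum => i; apply: measurable_funM => //.
  exact: (@measurable_tnth _ T).
exact: measurable_dot_lincomb.
Qed.

Definition tball (a : V) (r : R) : set (n.-tuple T) :=
  [set t | b (lincomb t - a) (lincomb t - a) <= r ^+ 2].

Lemma measurable_tball a r : measurable (tball a r).
Proof.
rewrite (_ : tball a r = [set t | b (lincomb t) (lincomb t) -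
    2 * b a (lincomb t) + b a a <= r ^+ 2]); last first.
  apply/seteqP; split => t; rewrite /tball /=;
  by have := dotZBB b 1 (lincomb t) a;
    rewrite scale1r expr1n mul1r mulr1 => ->.
rewrite -[X in measurable X]setTI.
apply: (measurable_fun_le measurableT) => //.
apply: measurable_funD => //; apply: measurable_funB.
  exact: measurable_dot2_lincomb.
by apply: measurable_funM => //; exact: measurable_dot_lincomb.
Qed.

Lemma lebesgue_tball_lty a r : (lebesgue_tuple R n (tball a r) < +oo)%E.
Proof.
have /choice[K /all_and2[K0 KP]] : forall i : 'I_n, exists K, 0 <= K /\
    forall v, `|coord e i v| <= K * Num.sqrt (b v v).
  by move=> i; have [K ? ?] := linear_dot_bounded b (coord e i); exists K.
(* The i-th summand bounds the i-th coordinate on the ball, since v - a has norm at most |r| there;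
   the sum bounds all coordinates at once. *)
pose M := \sum_i (K i * `|r| + `|coord e i a|).
apply: le_lt_trans (lebesgue_tuple_box_lty n M).
apply: le_measure; rewrite ?inE//.
- exact: measurable_tball.
- rewrite (_ : mkset _ = \bigcap_(i in [set: 'I_n])
    [set t | `|tnth t i| <= M]%R); last first.
    by apply/seteqP; split => t /= tM i; [move=> _|]; exact: tM.
  apply: fin_bigcap_measurable => // i _; rewrite -[X in measurable X]setTI.
  apply: (measurable_fun_le measurableT) => //.
  by apply: measurableT_comp => //; exact: (@measurable_tnth _ T).
move=> t /= ta i; rewrite -(coord_lincomb i t) -[lincomb t](subrK a) linearD.
apply: (le_trans (ler_normD _ _)).
rewrite /M (bigD1 i)//= -[leLHS]addr0 lerD//; last first.
  by apply: sumr_ge0 => j _; rewrite addr_ge0// mulr_ge0.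
by rewrite lerD2r (le_trans (KP _ _))// ler_wpM2l// -sqrtr_sqr ler_wsqrtr.
Qed.

End ball_in_coordinates.

(** * Intersection of a ray with a ball containing the origin *)

Section roots.
Context (R : realType) (V : vectType R) (b : {dot V for idfun}).
Implicit Types (a u : V) (r : R).

(* The endpoints of {x | q(x u - a) <= r^2}, for q(v) = b(v,v) *)
Definition rdisc a r u := b a u ^+ 2 - b u u * (b a a - r ^+ 2).
Definition hi_root a r u := (b a u + Num.sqrt (rdisc a r u)) / b u u.
Definition lo_root a r u := (b a u - Num.sqrt (rdisc a r u)) / b u u.

Lemma hi_rootN a r u : hi_root (- a) r u = - lo_root a r u.
Proof.
by rewrite /hi_root /lo_root /rdisc !(linearNl, linearNr) /= sqrrN opprK; ring.
Qed.

Context (a : V) (r : R) (u : V) (ar : b a a <= r ^+ 2) (u0 : u != 0).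

Let uu : 0 < b u u. Proof. exact: neq0_dnorm_gt0. Qed.

(** The hypothesis [ar] says that the origin lies in the ball; hence the roots are real and the
    origin of the ray lies between them. *)
Let disc_ge : b a u ^+ 2 <= rdisc a r u.
Proof. by rewrite /rdisc lerDl oppr_ge0 pmulr_rle0// subr_le0. Qed.

Let le_sqrt : `|b a u| <= Num.sqrt (rdisc a r u).
Proof. by rewrite -sqrtr_sqr ler_wsqrtr. Qed.

Lemma hi_root_ge0 : 0 <= hi_root a r u.
Proof.
rewrite divr_ge0 ?(ltW uu)//; have := le_sqrt.
by rewrite ler_norml => /andP[+ _]; rewrite -subr_ge0 opprK.
Qed.

Lemma hi_rootD_lo_root : hi_root a r u + lo_root a r u = 2 * b a u / b u u.
Proof. by rewrite /hi_root /lo_root; ring. Qed.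

Lemma hi_rootM_lo_root :
  hi_root a r u * lo_root a r u = (b u u)^-1 * (b a a - r ^+ 2).
Proof.
have -> : hi_root a r u * lo_root a r u =
  (b a u ^+ 2 - Num.sqrt (rdisc a r u) ^+ 2) / (b u u) ^+ 2.
  by rewrite /hi_root /lo_root expr2 invfM; ring.
rewrite sqr_sqrtr; last by rewrite (le_trans (sqr_ge0 _) disc_ge).
by rewrite /rdisc; field; rewrite gt_eqF.
Qed.

(** The inequality holds exactly between the two roots, and a positive x is above the lower one,
    which is at most 0. *)
Lemma ball_ray x : 0 < x ->
  (b (x *: u - a) (x *: u - a) <= r ^+ 2) = (x <= hi_root a r u).
Proof.
move=> x0; rewrite dotZBB /hi_root ler_pdivlMr// -lerBlDl.
have S2 : Num.sqrt (rdisc a r u) ^+ 2 = rdisc a r u.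
  by rewrite sqr_sqrtr// (le_trans (sqr_ge0 _) disc_ge).
have xu : 0 < x * b u u by exact: mulr_gt0.
have := le_sqrt; rewrite ler_norml.
set S := Num.sqrt _ in S2 *; rewrite /rdisc in S2 => /andP[S1 S3].
have S0 : 0 <= S by exact: sqrtr_ge0.
(* Completing the square turns membership in the ball into |x b(u,u) - b(a,u)| <= S. *)
have SE : S ^+ 2 - (x * b u u - b a u) ^+ 2 =
    b u u * (r ^+ 2 - (x ^+ 2 * b u u - 2 * x * b a u + b a a)).
  by rewrite S2; ring.
rewrite -subr_ge0 -(pmulr_rge0 _ uu) -SE subr_ge0.
have y_ge : - S <= x * b u u - b a u by lra.
rewrite -[RHS]andTb -y_ge -ler_norml -[(_ - _) ^+ 2]real_normK ?num_real//.
by rewrite ler_pXn2r// nnegrE.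
Qed.

End roots.

(** * Volumes of cones intersected with balls, in coordinates *)

Section cone_volume.
Context (R : realType) (V : vectType R) (k : nat) (e : k.+1.-tuple V).
Context (b : {dot V for idfun}).
Context (basis_e : basis_of {:V} e).
Local Notation T := (measurableTypeR R).
Local Notation W := (R^o * V)%type.
Local Notation hpoly := (@homogeneous_polynomial_function R W).
Local Notation nu := (lebesgue_tuple R k).
Local Notation vol := (lebesgue_tuple R k.+1).
Local Notation ball := (tball e b).

(** The vector u = (1, y), one on each ray of the open half-space. *)
Definition dir (y : k.-tuple T) : V := lincomb e (cons_pair ((1 : R) : T, y)).

(** This is q(u)^(-1/2), the upper root for a = 0 and R = 1. *)
Definition inv_norm (y : k.-tuple T) : R := (Num.sqrt (b (dir y) (dir y)))^-1.

Lemma dir_neq0 y : dir y != 0.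
Proof.
apply/eqP => y0.
have := coord_lincomb basis_e ord0 (cons_pair ((1 : R) : T, y)).
by rewrite -/(dir y) y0 linear0 => /esym/eqP; rewrite /tnth /= oner_eq0.
Qed.

Lemma dir_gt0 y : 0 < b (dir y) (dir y).
Proof. exact: neq0_dnorm_gt0 (dir_neq0 y). Qed.

Lemma inv_norm_ge0 y : 0 <= inv_norm y.
Proof. by rewrite invr_ge0 sqrtr_ge0. Qed.

Lemma inv_norm_sqr y : inv_norm y ^+ 2 = (b (dir y) (dir y))^-1.
Proof. by rewrite exprVn sqr_sqrtr// ltW// dir_gt0. Qed.

Lemma measurable_dot_dir a : measurable_fun setT (fun y => b a (dir y)).
Proof.
apply: (measurableT_comp (measurable_dot_lincomb e b a)).
exact: measurable_cons_cst (1 : R).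
Qed.

Lemma measurable_dir_inv :
  measurable_fun setT (fun y => (b (dir y) (dir y))^-1).
Proof.
(* For a nonnegative base the inverse is the real power -1, which is a measurable function. *)
under eq_fun do rewrite -powR_inv1 ?(ltW (dir_gt0 _))//.
apply: (measurableT_comp (measurable_powR (-1))).
apply: (measurableT_comp (measurable_dot2_lincomb e b)).
exact: measurable_cons_cst (1 : R).
Qed.

Definition even_hpoly d (h : W -> R) :=
  hpoly d h /\ forall (r : R) (a : V), h (r, a) = h (- r, a).

(* Finite sums of terms c(y) h(R,a) whose coefficient decays fast enough to be
   integrable in y when d = k + 1. *)
Inductive separated (d : nat) : (k.-tuple T -> W -> R) -> Prop :=
| separated_term (c : k.-tuple T -> R) K h :
    measurable_fun setT c -> (forall y, `|c y| <= K * inv_norm y ^+ d) ->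
    even_hpoly d h -> separated d (fun y w => c y * h w)
| separatedD F G : separated d F -> separated d G ->
    separated d (fun y w => F y w + G y w).

Lemma even_hpolyM d d' g h : even_hpoly d g -> even_hpoly d' h ->
  even_hpoly (d + d') (fun w => g w * h w).
Proof.
move=> [hg eg] [hh eh]; split; first exact: hpolyM.
by move=> r a; rewrite eg eh.
Qed.

(** Induction on both derivations reduces to two single terms, whose coefficients, bounds and
    polynomials multiply separately. *)
Lemma separatedM d d' F G : separated d F -> separated d' G ->
  separated (d + d') (fun y w => F y w * G y w).
Proof.
elim=> [c K h mc cK hh|F1 F2 _ IH1 _ IH2]; last first.
  move=> sG; rewrite (_ : (fun _ => _) =
      fun y w => F1 y w * G y w + F2 y w * G y w); last first.
    by apply/funext => y; apply/funext => w; rewrite mulrDl.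
  by apply: separatedD; [exact: IH1|exact: IH2].
elim=> [c' K' h' mc' cK' hh'|G1 G2 _ IH1 _ IH2]; last first.
  rewrite (_ : (fun _ => _) =
      fun y w => c y * h w * G1 y w + c y * h w * G2 y w); last first.
    by apply/funext => y; apply/funext => w; rewrite mulrDr.
  exact: separatedD.
rewrite (_ : (fun _ => _) = fun y w => (c y * c' y) * (h w * h' w)); last first.
  by apply/funext => y; apply/funext => w; rewrite mulrACA.
apply: (@separated_term _ _ (K * K')).
- exact: measurable_funM.
- move=> y; rewrite normrM exprD mulrACA; apply: ler_pM => //.
- exact: even_hpolyM.
Qed.

Lemma separated_cst (c : R) : separated 0 (fun _ _ => c).
Proof.
rewrite (_ : (fun _ => _) = fun _ _ => c * 1); last by rewrite mulr1.
apply: (@separated_term _ (fun=> c) `|c|) => //.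
  by move=> y; rewrite expr0 mulr1.
by split => //; exact: hpoly_cst.
Qed.

Lemma separatedZ d c F : separated d F -> separated d (fun y w => c * F y w).
Proof. by move=> sF; have := separatedM (separated_cst c) sF. Qed.

Lemma separated_sum d (I : Type) (s : seq I) F :
  (forall i, separated d (F i)) ->
  separated d (fun y w => \sum_(i <- s) F i y w).
Proof.
move=> sF; elim: s => [|i s IH].
  under eq_fun do under eq_fun do rewrite big_nil.
  (* The empty sum is put in the form of a term c(y) h(w) with both factors zero. *)
  rewrite (_ : (fun _ => _) = fun _ _ => 0 * 0); last by rewrite mulr0.
  apply: (@separated_term _ (fun=> 0) 0) => //.
    by move=> y; rewrite normr0 mul0r.
  by split => //; exact: hpoly0.
under eq_fun do under eq_fun do rewrite big_cons.
by apply: separatedD.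
Qed.

Lemma even_hpoly_coord i : even_hpoly 1 (fun w => coord e i w.2).
Proof.
split => //; apply: hpoly_linear => a u v.
by rewrite linearP.
Qed.

Lemma dot_coord a v : b a v = \sum_i coord e i a * b (tnth e i) v.
Proof.
rewrite {1}(coord_basis basis_e (memvf a)) linear_sumlz.
by apply: eq_bigr => i _; rewrite linearZl_LR /= (tnth_nth 0).
Qed.

(** Expanding a in the basis [e] separates a from y, and Cauchy-Schwarz bounds |b(e_i,u)| / q(u) by
    q(e_i)^(1/2) q(u)^(-1/2). *)
Lemma separated_root_sum :
  separated 1 (fun y w => 2 * b w.2 (dir y) / b (dir y) (dir y)).
Proof.
rewrite (_ : (fun _ => _) = fun y w => \sum_i
    (2 * b (tnth e i) (dir y) / b (dir y) (dir y)) * coord e i w.2); last first.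
  apply/funext => y; apply/funext => -[r a] /=.
  rewrite (dot_coord a) mulr_sumr mulr_suml.
  by apply: eq_bigr => i _; ring.
apply: separated_sum => i.
apply: (@separated_term _ _ (2 * Num.sqrt (b (tnth e i) (tnth e i)))).
- apply: measurable_funM; last exact: measurable_dir_inv.
  by apply: measurable_funM => //; exact: measurable_dot_dir.
- move=> y; rewrite expr1 -inv_norm_sqr expr2 !normrM.
  rewrite (ger0_norm (inv_norm_ge0 y)) ger0_norm// -!mulrA ler_pM2l// mulrA.
  rewrite ler_wpM2r ?inv_norm_ge0// ler_pdivrMr ?sqrtr_gt0 ?dir_gt0//.
  rewrite -sqrtrM ?dot_ge0// -sqrtr_sqr ler_wsqrtr//.
  exact: dot_CauchySchwarz.
- exact: even_hpoly_coord.
Qed.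

Lemma even_hpoly_dot : even_hpoly 2 (fun w => b w.2 w.2 - w.1 ^+ 2).
Proof.
split; last by move=> r a /=; rewrite sqrrN.
rewrite (_ : (fun w => _) = fun w => (\sum_i coord e i w.2 * b (tnth e i) w.2) +
    (-1) * (w.1 * w.1)); last first.
  apply/funext => -[r a] /=; rewrite mulN1r -expr2; congr (_ - _).
  exact: dot_coord.
apply: hpolyD.
  apply: hpoly_sum => i; apply: (@hpolyM _ _ 1 1).
    exact: (even_hpoly_coord i).1.
  by apply: hpoly_linear => c u v; rewrite linearDr /= dotZr.
by apply: hpolyZ; apply: (@hpolyM _ _ 1 1); apply: hpoly_linear.
Qed.

Lemma separated_root_prod :
  separated 2 (fun y w => (b (dir y) (dir y))^-1 * (b w.2 w.2 - w.1 ^+ 2)).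
Proof.
apply: (@separated_term _ _ 1) even_hpoly_dot; first exact: measurable_dir_inv.
by move=> y; rewrite mul1r inv_norm_sqr ger0_norm// invr_ge0 ltW// dir_gt0.
Qed.

Definition root_power_sum m (y : k.-tuple T) (w : W) : R :=
  power_sum (2 * b w.2 (dir y) / b (dir y) (dir y))
    ((b (dir y) (dir y))^-1 * (b w.2 w.2 - w.1 ^+ 2)) m.

(** The sum of the roots has degree 1 and their product degree 2, so both terms of Newton's
    recurrence have the right degree. *)
Lemma separated_root_power_sum m : separated m (root_power_sum m).
Proof.
have [] : separated m (root_power_sum m) /\
  separated m.+1 (root_power_sum m.+1); last by [].
elim: m => [|m [IH1 IH2]].
  by split; [exact: separated_cst|exact: separated_root_sum].
split=> //; have := separatedD (separatedM separated_root_sum IH2)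
  (separatedZ (-1) (separatedM separated_root_prod IH1)).
rewrite add1n; congr separated.
by apply/funext => y; apply/funext => w; rewrite mulN1r.
Qed.

(** The radial formula with [tau] the upper root; integrability comes from the finite volume of the
    ball. *)
Lemma lebesgue_half_cone_ball (D : set (k.+1.-tuple T)) a r :
  measurable D -> (forall t, D t -> 0 < thead t :> R) ->
  positively_homogeneous D -> b a a <= r ^+ 2 ->
  let f y := \1_[set y | D (cons_pair ((1 : R) : T, y))] y *
             (hi_root b a r (dir y) ^+ k.+1 / k.+1%:R) in
  nu.-integrable setT (EFin \o f) /\
  vol (D `&` ball a r) = (\int[nu]_y f y)%:E.
Proof.
move=> mD D0 Dc ar f.
have mDB : measurable (D `&` ball a r).
  by apply: measurableI => //; exact: measurable_tball.
have := @lebesgue_tuple_radial R k (D `&` ball a r)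
  [set y | D (cons_pair ((1 : R) : T, y))] (fun y => hi_root b a r (dir y)) mDB.
case.
- by move=> t [/D0].
- by move=> y; exact: hi_root_ge0 ar (dir_neq0 y).
(* By homogeneity x (1, y) lies in [D] exactly when (1, y) does: scale by x and by its inverse. *)
- move=> y x x0; rewrite /setI /tball /= lincombZ -/(dir y).
  rewrite (ball_ray ar (dir_neq0 y) x0); split=> -[Dxy ->]; split => //.
    rewrite -[cons_pair _](scale_tupleK _ (lt0r_neq0 x0)).
    by apply: Dc; rewrite ?invr_gt0.
  exact: Dc.
rewrite -/f => mf volE.
have f0 y : 0 <= f y.
  rewrite /f mulr_ge0 ?indic_ge0// ?divr_ge0// exprn_ge0//.
  exact: hi_root_ge0 ar (dir_neq0 y).
have foo : (\int[nu]_y (f y)%:E < +oo)%E.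
  rewrite -volE; apply: le_lt_trans (lebesgue_tball_lty b basis_e a r).
  by apply: le_measure; rewrite ?inE//; exact: measurable_tball.
split.
  apply/integrableP; split => //.
  by under eq_integral do rewrite /= ger0_norm//.
rewrite volE /Rintegral fineK// ge0_fin_numE// integral_ge0// => y _.
by rewrite lee_fin.
Qed.

(** The volume formula is applied to the unit half-ball centred at 0, where the upper root is
    [inv_norm y]. *)
Lemma integrable_inv_norm :
  nu.-integrable setT (fun y => (inv_norm y ^+ k.+1)%:E).
Proof.
have [] := @lebesgue_half_cone_ball (half_space R k) 0 1
  (@measurable_half_space R k).
- by [].
- by move=> c t c0 /= t0; rewrite /half_space /= /thead tnth_map mulr_gt0.
- by rewrite linear0l expr1n.
(* The factor k + 1 cancels the denominator in the volume formula. *)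
move=> /(integrableZl measurableT k.+1%:R) + _.
congr (_.-integrable _ _); apply/funext => y /=.
rewrite indicE mem_set /=; last by rewrite /half_space /= theadE.
rewrite mul1r -EFinM mulrCA mulfV ?pnatr_eq0// mulr1; congr ((_ ^+ _)%:E).
rewrite /hi_root /rdisc !linear0l expr0n expr1n sub0r add0r sub0r mulrN1 opprK.
rewrite /inv_norm -{2}(sqr_sqrtr (ltW (dir_gt0 y))) expr2 invfM mulrA.
by rewrite mulfV ?mul1r// sqrtr_eq0 -ltNge dir_gt0.
Qed.

(** In each term the coefficient, dominated by K q(u)^(-(k+1)/2), integrates to a constant, and the
    polynomial in w factors out. *)
Lemma separated_integral (E : set (k.-tuple T)) F :
  measurable E -> separated k.+1 F ->
  exists2 g, even_hpoly k.+1 g & forall w,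
    nu.-integrable setT (EFin \o (fun y => \1_E y * F y w)) /\
    \int[nu]_y (\1_E y * F y w) = g w.
Proof.
move=> mE; elim=> [c K h mc cK hh|F1 F2 _ [g1 hg1 IH1] _ [g2 hg2 IH2]].
  have ic : nu.-integrable setT (EFin \o (fun y => \1_E y * c y)).
    apply: le_integrable (integrableZl measurableT K integrable_inv_norm) => //.
      by apply/measurable_EFinP; apply: measurable_funM.
    move=> y _ /=; rewrite lee_fin (le_trans _ (ler_norm _))//.
    rewrite (le_trans _ (cK y))// normrM ler_piMl// indicE.
    by case: (_ \in _); rewrite ?normr1 ?normr0.
  exists (fun w => (\int[nu]_y (\1_E y * c y)) * h w).
    split; first exact/hpolyZ/hh.1.
    by move=> r a; rewrite hh.2.
  move=> w; split.
    have := integrableZr measurableT (h w) ic; congr (_.-integrable _ _).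
    by apply/funext => y /=; rewrite -EFinM mulrA.
  rewrite -RintegralZr//; apply: eq_Rintegral => y _; exact: mulrA.
exists (fun w => g1 w + g2 w).
  split; first exact: hpolyD hg1.1 hg2.1.
  by move=> r a; rewrite hg1.2 hg2.2.
move=> w; have [i1 e1] := IH1 w; have [i2 e2] := IH2 w; split.
  have := integrableD measurableT i1 i2; congr (_.-integrable _ _).
  by apply/funext => y /=; rewrite -EFinD mulrDr.
by rewrite -e1 -e2 -RintegralD//; apply: eq_Rintegral => y _; exact: mulrDr.
Qed.

(** On each ray of [D] the two volumes contribute (s+^n + s-^n) / n with n = k + 1, a separated
    function of degree n. *)
Lemma half_cone_volume (D : set (k.+1.-tuple T)) :
  measurable D -> (forall t, D t -> 0 < thead t :> R) ->
  positively_homogeneous D ->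
  exists2 g, even_hpoly k.+1 g & forall (r : R) a, b a a <= r ^+ 2 ->
    (vol (D `&` ball a r) + ((-1) ^+ k.+1)%:E * vol (D `&` ball (- a) r))%E =
    (g (r, a))%:E.
Proof.
move=> mD D0 Dc.
have mE := measurable_slice (1 : R) mD.
have [g hg gE] := separated_integral mE (separatedZ (k.+1%:R^-1)
  (separated_root_power_sum k.+1)).
exists g => // r a ar.
have [i1 ->] := lebesgue_half_cone_ball mD D0 Dc ar.
have ar' : b (- a) (- a) <= r ^+ 2 by rewrite linearNl /= linearNr /= opprK.
have [i2 ->] := lebesgue_half_cone_ball mD D0 Dc ar'.
rewrite -EFinM -EFinD -(gE (r, a)).2 -RintegralZl// -RintegralD//; last first.
  exact: (integrableZl measurableT ((-1) ^+ k.+1) i2).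
congr EFin; apply: eq_Rintegral => y _ /=.
rewrite /root_power_sum /= -(hi_rootD_lo_root b a r (dir y)).
rewrite -(hi_rootM_lo_root ar (dir_neq0 y)).
rewrite -[X in _ = _ * (_ * X)]/(power_sum _ _ k.+1) power_sumE.
(* The power of s- is rewritten through -s-, which is the upper root for -a. *)
have <- : (-1) ^+ k.+1 * (- lo_root b a r (dir y)) ^+ k.+1 =
    lo_root b a r (dir y) ^+ k.+1.
  by rewrite -exprMn mulN1r opprK.
rewrite hi_rootN; move: (_ ^+ _) (_ ^+ _) (_ ^+ _) => hn s ln; ring.
Qed.

(** The reflection t -> -t preserves volume, carries the part in t_0 < 0 into the half-space and
    turns the centre a into -a. *)
Lemma lebesgue_split_half_spaces (C : set (k.+1.-tuple T)) a r : measurable C ->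
  vol (C `&` ball a r) = (vol (C `&` half_space R k `&` ball a r) +
    vol (scale_tuple (-1) @^-1` C `&` half_space R k `&` ball (- a) r))%E.
Proof.
move=> mC; have mB := measurable_tball e b.
have mH := @measurable_half_space R k.
have mCB : measurable (C `&` ball a r) by exact: measurableI.
have mN := measurable_opp_tuple mH.
rewrite (measureDI _ mCB mH) addeC setIAC; congr (_ + _)%E.
rewrite (measureDI _ (measurableD mCB mH) mN).
(* What lies neither in the half-space nor in its reflection has t_0 = 0. *)
rewrite [X in (X + _)%E](_ : _ = 0%E) ?add0e; last first.
  apply/eqP; rewrite eq_le measure_ge0 andbT -(lebesgue_tuple_hyperplane R k).
  apply: le_measure; rewrite ?inE.
  - by apply: measurableD => //; exact: measurableD.
  - rewrite -[X in measurable X]setTI.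
    have m0 := measurable_set1 (0 : R).
    exact: (@measurable_tnth _ T k.+1 ord0 measurableT _ m0).
  - move=> t /= [[_ /negP]]; rewrite -leNgt /half_space /= => t0.
    rewrite /thead tnth_map => /negP; rewrite -leNgt mulN1r oppr_le0 => t0'.
    by apply/eqP; rewrite eq_le t0 t0'.
rewrite -lebesgue_opp_tuple; last first.
  apply: measurableI => //; apply: measurableI => //.
  exact: measurable_opp_tuple.
congr (lebesgue_tuple R k.+1 _); apply/seteqP.
have ballN t : ball (- a) r (scale_tuple (-1) t) = ball a r t.
  rewrite /tball /= lincombZ scaleN1r -opprD.
  by rewrite linearNl /= linearNr /= opprK.
split => t; rewrite /setI /setD /preimage /= scale_tupleN1K ballN.
  by move=> [[[Ct Bt] _] Ht].
move=> [[Ct Ht] Bt]; split => //; split => //.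
move: Ht; rewrite /half_space /= /thead tnth_map mulN1r oppr_gt0 => t0.
by apply/negP; rewrite -leNgt ltW.
Qed.

(** Splitting [C] and its reflection [N] yields four half-cone volumes, which regroup as the
    half-cone identity for [C] plus (-1)^n times the one for [N], where n = k + 1. *)
Lemma cone_volume (C : set (k.+1.-tuple T)) :
  measurable C -> positively_homogeneous C ->
  exists2 g, even_hpoly k.+1 g & forall (r : R) a, b a a <= r ^+ 2 ->
    (vol (C `&` ball a r) +
     ((-1) ^+ k.+1)%:E * vol (scale_tuple (-1) @^-1` C `&` ball a r))%E =
    (g (r, a))%:E.
Proof.
move=> mC hC; set N := scale_tuple (-1) @^-1` C.
have mN : measurable N by exact: measurable_opp_tuple.
have hN : positively_homogeneous N.
  move=> c t c0; rewrite /N /preimage /=.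
  suff -> : scale_tuple (-1) (scale_tuple c t) =
      scale_tuple c (scale_tuple (-1) t).
    exact: hC.
  by apply: eq_from_tnth => i; rewrite !tnth_map mulrCA.
have half D : measurable D -> positively_homogeneous D ->
    exists2 g, even_hpoly k.+1 g & forall (r : R) a, b a a <= r ^+ 2 ->
    (vol (D `&` half_space R k `&` ball a r) + ((-1) ^+ k.+1)%:E *
     vol (D `&` half_space R k `&` ball (- a) r))%E = (g (r, a))%:E.
  move=> mD hD; apply: half_cone_volume.
  - by apply: measurableI => //; exact: measurable_half_space.
  - by move=> t [].
  - move=> c t c0 [Dt t0]; split; first exact: hD.
    by rewrite /half_space /= /thead tnth_map mulr_gt0.
have [g1 hg1 g1E] := half C mC hC; have [g2 hg2 g2E] := half N mN hN.
exists (fun w => g1 w + (-1) ^+ k.+1 * g2 w).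
  split; first exact: hpolyD hg1.1 (hpolyZ _ hg2.1).
  by move=> r a; rewrite hg1.2 hg2.2.
have NN : scale_tuple (-1) @^-1` N = C.
  by apply/seteqP; split => t; rewrite /N /preimage /= scale_tupleN1K.
have fin_ball D a r : measurable D -> exists x, vol (D `&` ball a r) = x%:E.
  move=> mD; exists (fine (vol (D `&` ball a r))).
  rewrite fineK// ge0_fin_numE//.
  apply: le_lt_trans (lebesgue_tball_lty b basis_e a r).
  apply: le_measure; rewrite ?inE//; last exact: measurable_tball.
  by apply: measurableI => //; exact: measurable_tball.
move=> r a ar; move: (g1E r a ar) (g2E r a ar).
rewrite (lebesgue_split_half_spaces a r mC) (lebesgue_split_half_spaces a r mN).
rewrite NN -/N.
have mCH : measurable (C `&` half_space R k).
  by apply: measurableI => //; exact: measurable_half_space.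
have mNH : measurable (N `&` half_space R k).
  by apply: measurableI => //; exact: measurable_half_space.
have [x1 ->] := fin_ball _ a r mCH; have [x2 ->] := fin_ball _ (- a) r mCH.
have [y1 ->] := fin_ball _ a r mNH; have [y2 ->] := fin_ball _ (- a) r mNH.
rewrite -!(EFinM, EFinD) => -[<-] [<-]; congr EFin.
rewrite [in RHS]mulrDr [in RHS]mulrA.
(* The two signs in front of the volume of the half of [N] in the ball around -a multiply to 1. *)
by rewrite -[X in _ = _ + (_ + X * _)]expr2 sqrr_sign; ring.
Qed.

End cone_volume.

(** * From coordinates back to cones in V *)

Lemma cone_volume_polynomial (R : realType) (V : vectType R) (n : nat)
    (e : n.-tuple V) (b : {dot V for idfun}) (C : set V) :
  basis_of {:V} e -> measurable [set t | C (lincomb e t)] -> C 0 ->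
  (forall c v, 0 < c -> C v -> C (c *: v)) ->
  exists2 g, @even_hpoly R V n g & forall (r : R) a, b a a <= r ^+ 2 ->
    (lebesgue_tuple R n
       [set t | (C `&` qball (fun x => b x x) a r) (lincomb e t)] +
     ((-1) ^+ n)%:E * lebesgue_tuple R n
       [set t | ((-%R @` C) `&` qball (fun x => b x x) a r) (lincomb e t)])%E =
    (g (r, a))%:E.
Proof.
move=> basis_e mC C0 hC; case: n e basis_e mC => [|k] e basis_e mC.
  (* For n = 0 there is no coordinate t_0 to slice along. The measure is a point mass at the only
     tuple, and 0 lies in both cones and in the ball, so each volume is 1. *)
  exists (fun=> 2); first by split => //; exact: hpoly_cst.
  move=> r a ar.
  have V0 t : lincomb e t = 0 by rewrite /lincomb big_ord0.
  have ball0 : qball (fun x => b x x) a r 0.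
    by rewrite /qball /= sub0r linearNl /= linearNr /= opprK.
  rewrite /= !diracE !mem_set ?mul1e//; rewrite /= V0; split=> //.
  by exists 0; rewrite ?oppr0.
have [|g hg gE] := @cone_volume R V k e b basis_e [set t | C (lincomb e t)] mC.
  by move=> c t c0 /= Ct; rewrite lincombZ; exact: hC.
exists g => // r a ar; rewrite -(gE r a ar).
congr (_ + _ * _)%E; congr (lebesgue_tuple R k.+1 _).
apply/seteqP; split => t /=;
  rewrite /setI /preimage /= lincombZ scaleN1r.
  by move=> [[v Cv vE] Bv]; split => //; rewrite -vE opprK.
by move=> [Ct Bt]; split => //; exists (- lincomb e t); rewrite ?opprK.
Qed.

Theorem theorem7p4 (R : realType) (n : nat) (V : vectType R)
    (dimV : \dim {:V} = n) (dot : {dot V for idfun})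
    (q : V -> R) (q_quad : quadratic_form q) (q_pos : positive_definite q)
    (C : set V) (C_cone : polyhedral_cone dot C) :
  exists g : R^o * V -> R,
    [/\ polynomial_function g,
        homogeneous_polynomial_function n g,
        forall (r : R) (a : V), g (r, a) = g (- r, a) &
        forall (r : R) (a : V), q a <= r ^+ 2 ->
          (Vol dot (C `&` qball q a r)
           + ((-1) ^+ n)%:E * Vol dot ((-%R @` C) `&` qball q a r))%E
          = (g (r, a))%:E].
Proof.
case: n / dimV; have [[f [bilinear_f hermitian_f]] /= qE] := q_quad.
have f_pos u : u != 0 -> 0 < f u u by move=> u0; rewrite -qE; exact: q_pos.
(* The bilinear form of [q] is a second inner product: it defines the balls, while [dot] supplies
   the coordinates and the half-spaces. *)
pose b : {dot V for idfun} :=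
  Dot.Pack (Dot.Class (isDotProduct.Build R V f f_pos) bilinear_f hermitian_f).
have -> : q = fun x => b x x by exact/funext.
have [s _ CE] := C_cone.
have /andP[basis_e _] := orthonormal_basisP dot.
have [||c v c0|g [hg geven] gE] := @cone_volume_polynomial R V _ _ b C basis_e.
- rewrite (_ : mkset _ = \bigcap_(w in [set` s])
      [set t | 0 <= dot w (lincomb (orthonormal_basis dot) t)]); last first.
    by rewrite CE; apply/seteqP; split.
  apply: fin_bigcap_measurable => [|w _]; first exact: finite_seq.
  rewrite -[X in measurable X]setTI.
  by apply: measurable_fun_le => //; exact: measurable_dot_lincomb.
- by rewrite CE => w _; rewrite /closed_half_space /= linear0r.
- rewrite CE => Cv w ws; rewrite /closed_half_space /= dotZr.
  by rewrite mulr_ge0 ?(ltW c0)//; exact: Cv.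
(* By definition [Vol dot] is measured in the coordinates of [orthonormal_basis dot], so [gE] is the
   volume identity itself. *)
exists g; split => //; exact: homogeneous_polynomial hg.
Qed.
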